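(* Let $\lambda_1,\lambda_2,\lambda_1',\lambda_2',\sigma_1,\sigma_2,\sigma_1',\sigma_2'\in\mathbb{C}^*$ and $\eta_1,\eta_2,\eta_1',\eta_2'\in\mathbb{C}$ with $\lambda_1\neq\lambda_2$ and $\lambda_1'\neq\lambda_2'$. Then the irreducible $\mathcal{G}$-modules $\Omega(\lambda_1,\eta_1,0,\sigma_1)\otimes\Omega(\lambda_2,\eta_2,0,\sigma_2)$ and $\Omega(\lambda_1',\eta_1',0,\sigma_1')\otimes\Omega(\lambda_2',\eta_2',0,\sigma_2')$ are isomorphic if and only if either $(\lambda_1,\eta_1,\sigma_1)=(\lambda_1',\eta_1',\sigma_1')$ and $(\lambda_2,\eta_2,\sigma_2)=(\lambda_2',\eta_2',\sigma_2')$, or $(\lambda_1,\eta_1,\sigma_1)=(\lambda_2',\eta_2',\sigma_2')$ and $(\lambda_2,\eta_2,\sigma_2)=(\lambda_1',\eta_1',\sigma_1')$.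
   Context: The planar Galilean conformal algebra $\mathcal{G}$ is the complex Lie algebra with basis $\{L_m,H_m,I_m,J_m\mid m\in\mathbb{Z}\}$ and brackets $[L_m,L_n]=(n-m)L_{m+n}$, $[L_m,H_n]=nH_{m+n}$, $[L_m,I_n]=(n-m)I_{m+n}$, $[L_m,J_n]=(n-m)J_{m+n}$, $[H_m,I_n]=I_{m+n}$, $[H_m,J_n]=-J_{m+n}$, and $[H_m,H_n]=[I_m,I_n]=[J_m,J_n]=[I_m,J_n]=0$ for all $m,n\in\mathbb{Z}$. For $\lambda,\sigma\in\mathbb{C}^*$, $\eta\in\mathbb{C}$, the module $\Omega(\lambda,\eta,0,\sigma)$ is $\mathbb{C}[S,T]$ with $L_m f(S,T)=\lambda^m(T+mS+m\eta)f(S,T-m)$, $H_m f(S,T)=\lambda^m S f(S,T-m)$, $I_m f(S,T)=0$, $J_m f(S,T)=\lambda^m\sigma f(S+1,T-m)$. The tensor product of $\mathcal{G}$-modules has action $x(v\otimes w)=xv\otimes w+v\otimes xw$. (When $\lambda_1\neq\lambda_2$ these tensor products are irreducible.) *)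

(* Defs.v *)
From HB Require Import structures.
From mathcomp Require Import all_boot all_order all_algebra.
From mathcomp Require Import Rstruct complex.
From mathcomp Require Import mpoly.
Set Implicit Arguments. Unset Strict Implicit. Unset Printing Implicit Defensive.
Import GRing.Theory Num.Theory.
Local Open Scope ring_scope.

Notation C := (complex Rdefinitions.R).

(* Carrier of Omega(l1,e1,0,s1) (x) Omega(l2,e2,0,s2):
   C[S1,T1] (x) C[S2,T2] = C[S1,T1,S2,T2], variables indexed
   0 = S1, 1 = T1, 2 = S2, 3 = T2.  f (x) g  corresponds to  f(S1,T1) g(S2,T2). *)
Definition Mod := {mpoly C[4]}.

(* The basis elements of the planar Galilean conformal algebra:
   (gL, m) = L_m, (gH, m) = H_m, (gI, m) = I_m, (gJ, m) = J_m. *)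
Inductive gen := gL | gH | gI | gJ.

Definition shiftv (d : 'I_4 -> C) (f : Mod) : Mod :=
  f \mPo [tuple ('X_j + (d j)%:MP) | j < 4].

(* Action of the basis element (g, m) on Omega(lam, eta, 0, sig), acting on the
   variables S = X_s, T = X_t of a polynomial in C[S1,T1,S2,T2]. *)
Definition omega_act (s t : 'I_4) (lam eta sig : C) (g : gen) (m : int) (f : Mod)
  : Mod :=
  let shT := shiftv (fun j => if j == t then - (m%:~R) else 0) f in
  match g with
  | gL => lam ^ m *: (('X_t + (m%:~R : C) *: 'X_s + (m%:~R * eta)%:MP) * shT)
  | gH => lam ^ m *: ('X_s * shT)
  | gI => 0
  | gJ => (lam ^ m * sig) *:
            shiftv (fun j => if j == t then - (m%:~R) else if j == s then 1 else 0) f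
  end.

Definition i0 : 'I_4 := @Ordinal 4 0 isT.
Definition i1 : 'I_4 := @Ordinal 4 1 isT.
Definition i2 : 'I_4 := @Ordinal 4 2 isT.
Definition i3 : 'I_4 := @Ordinal 4 3 isT.

(* Action on Omega(l1,e1,0,s1) (x) Omega(l2,e2,0,s2):
   x (v (x) w) = x v (x) w + v (x) x w. *)
Definition tensor_act (l1 e1 s1 l2 e2 s2 : C) (g : gen) (m : int) (f : Mod) : Mod :=
  omega_act i0 i1 l1 e1 s1 g m f + omega_act i2 i3 l2 e2 s2 g m f.

Definition G_iso (act1 act2 : gen -> int -> Mod -> Mod) : Prop :=
  exists phi : {linear Mod -> Mod},
    bijective phi /\ forall g m f, phi (act1 g m f) = act2 g m (phi f).

(* Main.v *)
(* Let phi be an isomorphism and p = phi 1. On 1 the operators J_m act by the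
   scalars l1^m s1 + l2^m s2, so at every point v
     l1'^m s1' p(S1+1, T1-m, S2, T2) + l2'^m s2' p(S1, T1, S2+1, T2-m)
       = (l1^m s1 + l2^m s2) p,
   an identity between exponential polynomials in m. Comparing both sides base
   by base gives {l1, l2} = {l1', l2'}, and, after matching the bases, that p is
   an eigenvector of each of the shifts; hence p is a constant c and s = s'.
   The operators H_m then give phi S1 = c S1, and the coefficient of l1^m m in
   the identity for L_m gives e1 = e1'. The second factor, and the case of
   exchanged bases, reduce to this one by the flip of the two tensor factors. *)
Require Import Defs.
From HB Require Import structures.
From mathcomp Require Import all_boot all_order all_algebra.
From mathcomp Require Import Rstruct complex.
From mathcomp Require Import mpoly.
From mathcomp Require Import ring.
Import GRing.Theory Num.Theory.
Local Open Scope ring_scope.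
Set Implicit Arguments.
Unset Strict Implicit.

(** * Polynomials that vanish at all natural points *)

Lemma poly_natr_eq0 (F : numDomainType) (q : {poly F}) :
  (forall n : nat, q.[n%:R] = 0) -> q = 0.
Proof.
move=> q0; apply: (@roots_geq_poly_eq0 _ _ [seq i%:R | i <- iota 0 (size q)]).
- by apply/allP=> _ /mapP[i _ ->]; rewrite /root q0.
- by rewrite map_inj_uniq ?iota_uniq //; apply: mulrIn; rewrite oner_eq0.
- by rewrite size_map size_iota.
Qed.

Local Notation widen := (widen_ord (leqnSn _)).

Lemma meval_muni (F : comNzRingType) n (p : {mpoly F[n.+1]}) (v : 'I_n.+1 -> F) :
  p.@[v] = (map_poly (meval (fun i => v (widen i))) (muni p)).[v ord_max].
Proof.
rewrite {1}(mpolyE p) muniE !raddf_sum /= horner_sum; apply: eq_bigr => m _.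
rewrite map_polyZ map_polyXn hornerZ hornerXn /= !mevalZ !mevalX.
rewrite -mulrA; congr (_ * _).
by rewrite big_ord_recr /=; congr (_ * _); apply: eq_bigr => i _; rewrite mnmE.
Qed.

(** The coefficient of [m] in [p] is found inside the coefficient of degree [m ord_max] of [muni p],
    at [m] without its last exponent; these two data determine [m]. *)
Lemma muni_eq0 (F : nzRingType) n (p : {mpoly F[n.+1]}) : muni p = 0 -> p = 0.
Proof.
move=> p0; apply/mpolyP=> m; rewrite mcoeff0.
have /(congr1 (fun q : {poly {mpoly F[n]}} =>
    (q`_(m ord_max))@_[multinom m (widen i) | i < n])) := p0.
rewrite muniE coef_sum raddf_sum coef0 mcoeff0 /=.
under eq_bigr => k _ do rewrite coefZ coefXn.
have [mp|/memN_msupp_eq0//] := boolP (m \in msupp p).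
rewrite (bigD1_seq m) ?msupp_uniq //= eqxx mulr1 mcoeffZ mcoeffX eqxx mulr1.
rewrite big1 ?addr0 // => k km.
case: eqP => [Ek|_]; rewrite ?mulr0 ?mcoeff0 // mulr1 mcoeffZ mcoeffX.
case: eqP => [/mnmP Em|_]; rewrite ?mulr0 //.
case/eqP: km; apply/mnmP => i; case: (unliftP ord_max i) => [j ->|-> //].
have := Em j; rewrite !mnmE.
by have -> : widen j = lift ord_max j by apply/val_inj; rewrite /= /bump leqNgt ltn_ord.
Qed.

(** Induction on the number of variables: with all but the last variable fixed at natural values, a
    univariate polynomial vanishing on the naturals remains, so each coefficient of [muni p] falls
    under the induction hypothesis. *)
Lemma mpoly_natr_eq0 (F : numDomainType) n (p : {mpoly F[n]}) :
  (forall v : 'I_n -> nat, p.@[fun i => (v i)%:R] = 0) -> p = 0.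
Proof.
elim: n p => [|n IHn] p p0.
  by have := p0 (fun=> 0%N); rewrite (nvar0_mpolyC p) mevalC => ->.
apply: muni_eq0; apply/polyP => k; rewrite coef0; apply: IHn => v.
pose w m (i : 'I_n.+1) := if unlift ord_max i is Some j then v j else m.
suff /(congr1 (fun q : {poly F} => q`_k)) :
    map_poly (meval (fun i => (v i)%:R)) (muni p) = 0.
  by rewrite coef_map coef0.
apply: poly_natr_eq0 => m; have := p0 (w m); rewrite meval_muni /w unlift_none.
move=> <-; congr (_.[_]); apply: eq_map_poly => q; apply: meval_eq => i.
have -> : widen i = lift ord_max i.
  by apply/val_inj; rewrite /= /bump leqNgt ltn_ord.
by rewrite liftK.
Qed.

(** * Linear independence of exponential polynomials *)

(* Induction on the total size of the q a: if q a <> 0, the difference operator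
   u(n) |-> u(n+1) - a u(n) lowers the size of q a and, for b <> a, multiplies
   the leading coefficient of q b by b - a <> 0. *)
Lemma exp_poly_eq0 (F : numDomainType) (r : seq F) (q : F -> {poly F}) :
  uniq r -> 0 \notin r ->
  (forall n : nat, \sum_(a <- r) a ^+ n * (q a).[n%:R] = 0) ->
  forall a, a \in r -> q a = 0.
Proof.
move=> r_uniq r0.
have [N] := ubnP (\sum_(a <- r) size (q a)); elim: N q => // N IHN q ltN q0 a ar.
apply/eqP/negPn/negP => qa0.
pose q' b := b *: (q b \Po ('X + 1%:P)) - a *: q b.
have size_q' b : b \in r -> (size (q' b) <= size (q b))%N.
  move=> br; rewrite (leq_trans (size_polyD _ _)) // size_polyN geq_max.
  rewrite !(leq_trans (size_scale_leq _ _)) //.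
  by rewrite size_comp_poly2 // size_XaddC.
have lead_shift b : lead_coef (q b \Po ('X + 1%:P)) = lead_coef (q b).
  by rewrite lead_coef_comp ?size_XaddC // lead_coefXaddC expr1n mulr1.
have coef_q' b : (q' b)`_(size (q b)).-1 = (b - a) * lead_coef (q b).
  rewrite coefB !coefZ mulrBl -{1}lead_shift [in RHS]/lead_coef.
  by rewrite size_comp_poly2 ?size_XaddC.
have size_q'a : (size (q' a) < size (q a))%N.
  rewrite ltn_neqAle size_q' // andbT; apply/eqP => Es.
  have /eqP := coef_q' a; rewrite subrr mul0r -Es lead_coef_eq0 -size_poly_eq0 Es.
  by rewrite size_poly_eq0 (negPf qa0).
have q'0 : forall b, b \in r -> q' b = 0.
  apply: IHN.
    rewrite -ltnS; apply: leq_trans ltN; rewrite ltnS.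
    rewrite (bigD1_seq a) //= [ltnRHS](bigD1_seq a) //= -addSn leq_add //.
    rewrite big_seq_cond [leqRHS]big_seq_cond.
    by apply: leq_sum => b /andP[br _]; exact: size_q'.
  move=> n; rewrite -[RHS](q0 n.+1) -[RHS]subr0.
  rewrite -[X in _ = _ - X](mulr0 a) -[X in a * X](q0 n).
  rewrite mulr_sumr -sumrB; apply: eq_bigr => b _.
  rewrite /q' hornerD hornerN !hornerZ horner_comp !hornerE natr1 exprSr.
  by rewrite mulrBr mulrA; congr (_ - _); rewrite mulrCA; exact: mulrA.
have q0b b : b \in r -> b != a -> q b = 0.
  move=> br ba; apply/eqP; rewrite -lead_coef_eq0.
  have /eqP := coef_q' b; rewrite q'0 // coef0 eq_sym mulf_eq0 subr_eq0.
  by rewrite (negPf ba).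
case/eqP: qa0; apply: poly_natr_eq0 => n; have /eqP := q0 n.
rewrite (bigD1_seq a) //= big_seq_cond big1 => [|b /andP[br ba]]; last first.
  by rewrite q0b // horner0 mulr0.
rewrite addr0 mulf_eq0 expf_eq0 => /orP[/andP[_ /eqP a0]|/eqP//].
by rewrite -a0 ar in r0.
Qed.

(** Repeated bases are allowed here: terms with the same base are summed before independence is
    applied. *)
Lemma exp_poly_collect (F : numDomainType) (s : seq (F * {poly F})) :
  0 \notin unzip1 s ->
  (forall n : nat, \sum_(x <- s) x.1 ^+ n * x.2.[n%:R] = 0) ->
  forall a, \sum_(x <- s | x.1 == a) x.2 = 0.
Proof.
move=> s0 sum0 a.
have [ar|ans] := boolP (a \in unzip1 s); last first.
  rewrite big_seq_cond big1 // => x /andP[xs /eqP xa]; case/negP: ans.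
  by rewrite -xa map_f.
pose q b := \sum_(x <- s | x.1 == b) x.2.
apply: (@exp_poly_eq0 _ (undup (unzip1 s)) q); rewrite ?undup_uniq ?mem_undup //.
move=> n; rewrite -[RHS](sum0 n) /q.
under eq_bigr => b _ do rewrite horner_sum mulr_sumr.
rewrite (exchange_big_dep xpredT) //=.
rewrite [LHS]big_seq [RHS]big_seq; apply: eq_bigr => x xs.
rewrite -big_filter (@eq_filter _ _ (pred1 x.1)) => [|b]; last first.
  by rewrite /= eq_sym.
by rewrite filter_pred1_uniq ?undup_uniq ?mem_undup ?map_f // big_seq1.
Qed.

(** All terms are moved to one side and those of base [l1] collected. The boolean multiples leave
    open which of [k1], [k2] equal [l1]. *)
Lemma exp_poly_match (F : numDomainType) (l1 l2 k1 k2 : F) (p1 p2 q1 q2 : {poly F}) :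
  l1 != 0 -> l2 != 0 -> k1 != 0 -> k2 != 0 -> l1 != l2 ->
  (forall n : nat, l1 ^+ n * p1.[n%:R] + l2 ^+ n * p2.[n%:R] =
                   k1 ^+ n * q1.[n%:R] + k2 ^+ n * q2.[n%:R]) ->
  p1 = q1 *+ (k1 == l1) + q2 *+ (k2 == l1).
Proof.
move=> l1n0 l2n0 k1n0 k2n0 l12 E.
pose s := [:: (l1, p1); (l2, p2); (k1, - q1); (k2, - q2)].
have : \sum_(x <- s | x.1 == l1) x.2 = 0.
  apply: exp_poly_collect.
    by rewrite !inE ![0 == _]eq_sym !negb_or l1n0 l2n0 k1n0.
  move=> n; rewrite !big_cons big_nil /= !hornerN !mulrN addr0 addrA E.
  by rewrite -opprD subrr.
rewrite !big_cons big_nil /= eqxx [l2 == l1]eq_sym (negPf l12).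
case: (k1 == l1); case: (k2 == l1); rewrite /= ?addr0 -?opprD;
  by move/eqP; rewrite ?subr_eq0 ?mulr1n ?mulr0n ?add0r ?addr0 => /eqP.
Qed.

(** * Multivariate polynomials: evaluation, periodicity, restriction to lines *)

Lemma meval_inj (F : numDomainType) n (p q : {mpoly F[n]}) :
  (forall v, p.@[v] = q.@[v]) -> p = q.
Proof.
move=> pq; apply/eqP; rewrite -subr_eq0; apply/eqP/mpoly_natr_eq0 => v.
by rewrite mevalB pq subrr.
Qed.

(** A natural point descends to the origin by unit steps along coordinates that are still nonzero,
    where truncated subtraction is exact; so [p] minus its value at the origin vanishes at all
    natural points. *)
Lemma mpoly_periodic_const (F : numDomainType) n (p : {mpoly F[n]}) :
  (forall i v, p.@[fun j => v j + (j == i)%:R] = p.@[v]) ->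
  p = (p.@[fun=> 0])%:MP.
Proof.
move=> pP; apply/eqP; rewrite -subr_eq0; apply/eqP/mpoly_natr_eq0 => v.
apply/eqP; rewrite mevalB mevalC subr_eq0; apply/eqP.
have [N] := ubnP (\sum_i v i); elim: N v => // N IHN v ltN.
case: (pickP (fun i => v i != 0%N)) => [i vi|v0]; last first.
  by apply: meval_eq => j; move/negbFE/eqP: (v0 j) => ->.
have le_iv j : ((j == i) <= v j)%N by case: eqP => // ->; rewrite lt0n.
rewrite -(IHN (fun j => v j - (j == i))%N); last first.
  rewrite -ltnS; apply: leq_trans ltN; rewrite ltnS.
  rewrite (bigD1 i) //= [ltnRHS](bigD1 i) //= eqxx -addSn leq_add //.
    by rewrite subn1 prednK // lt0n.
  by apply: leq_sum => j _; exact: leq_subr.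
by rewrite -[RHS](pP i); apply: meval_eq => j /=; rewrite -natrD subnK.
Qed.

Definition mline (F : comNzRingType) n (u w : 'I_n -> F) (p : {mpoly F[n]}) : {poly F} :=
  mmap polyC (fun i => (u i)%:P + w i *: 'X) p.

Lemma horner_mline (F : comNzRingType) n (u w : 'I_n -> F) (p : {mpoly F[n]}) x :
  (mline u w p).[x] = p.@[fun i => u i + w i * x].
Proof.
rewrite /mline mevalE /mmap horner_sum; apply: eq_bigr => m _.
rewrite hornerM hornerC /mmap1 horner_prod; congr (_ * _).
by apply: eq_bigr => i _; rewrite horner_exp !hornerE.
Qed.

(** * Shifts, renaming of variables and the flip of the tensor factors *)

Lemma Mod_eq (f g : Mod) : (forall v, f.@[v] = g.@[v]) -> f = g.
Proof. exact: meval_inj. Qed.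

Lemma meval_shiftv d (f : Mod) v : (shiftv d f).@[v] = f.@[fun j => v j + d j].
Proof.
rewrite /shiftv comp_mpoly_meval; apply: meval_eq => i.
by rewrite tnth_mktuple mevalD mevalXU mevalC.
Qed.

Lemma shiftv1 d : shiftv d 1 = 1.
Proof. exact: comp_mpoly1. Qed.

Lemma shiftvZ d c f : shiftv d (c *: f) = c *: shiftv d f.
Proof. exact: comp_mpolyZ. Qed.

(* Otherwise matching a [meval] pattern unfolds [shiftv] and does not terminate
   in practice. *)
Local Opaque shiftv.

Definition relabel (pi : 'I_4 -> 'I_4) (f : Mod) : Mod :=
  f \mPo [tuple 'X_(pi j) | j < 4].

Lemma meval_relabel pi f v : (relabel pi f).@[v] = f.@[fun j => v (pi j)].
Proof.
rewrite /relabel comp_mpoly_meval; apply: meval_eq => i.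
by rewrite tnth_mktuple mevalXU.
Qed.

Lemma relabelD pi f g : relabel pi (f + g) = relabel pi f + relabel pi g.
Proof. exact: comp_mpolyD. Qed.

Lemma relabel_shiftv pi d e f :
  (forall j, d j = e (pi j)) -> relabel pi (shiftv d f) = shiftv e (relabel pi f).
Proof.
move=> de; apply: Mod_eq => v.
rewrite [LHS]meval_relabel [RHS]meval_shiftv [LHS]meval_shiftv [RHS]meval_relabel.
by apply: meval_eq => j; rewrite de.
Qed.

(** Injectivity of [pi] makes the test [pi j == pi t] agree with [j == t], so renaming carries each
    shift to the corresponding shift. *)
Lemma relabel_omega pi s t lam eta sig g m f : injective pi ->
  relabel pi (omega_act s t lam eta sig g m f) =
  omega_act (pi s) (pi t) lam eta sig g m (relabel pi f).
Proof.
move=> pi_inj; apply: Mod_eq => v; rewrite [LHS]meval_relabel.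
have sh d d' : (forall j, d j = d' (pi j)) ->
    (shiftv d f).@[fun j => v (pi j)] = (shiftv d' (relabel pi f)).@[v].
  by move=> dd'; rewrite -(relabel_shiftv _ dd') [RHS]meval_relabel.
have shT : (shiftv (fun j => if j == t then - m%:~R else 0) f).@[fun j => v (pi j)] =
    (shiftv (fun j => if j == pi t then - m%:~R else 0) (relabel pi f)).@[v].
  by apply: sh => j; rewrite inj_eq.
case: g; rewrite /omega_act.
- move: (shiftv _ _) (shiftv _ _) shT => X Y XY.
  by rewrite !mevalZ !mevalM !mevalD !mevalZ !mevalXU !mevalC XY.
- move: (shiftv _ _) (shiftv _ _) shT => X Y XY.
  by rewrite !mevalZ !mevalM !mevalXU XY.
- by rewrite !meval0.
- have : (shiftv (fun j => if j == t then - m%:~R else if j == s then 1 else 0) f).@[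
      fun j => v (pi j)] =
    (shiftv (fun j => if j == pi t then - m%:~R else if j == pi s then 1 else 0)
      (relabel pi f)).@[v].
    by apply: sh => j; rewrite !inj_eq.
  by move: (shiftv _ _) (shiftv _ _) => X Y XY; rewrite !mevalZ XY.
Qed.

Definition swap_factor (j : 'I_4) : 'I_4 :=
  if j == i0 then i2 else if j == i1 then i3 else if j == i2 then i0 else i1.

Lemma swap_factorK : involutive swap_factor.
Proof. by case=> [] [|[|[|[|]]]] // lt_j; apply/val_inj. Qed.

Lemma relabelK pi : involutive pi -> involutive (relabel pi).
Proof.
move=> piK f; apply: Mod_eq => v; rewrite [LHS]meval_relabel [LHS]meval_relabel.
by apply: meval_eq => j; rewrite piK.
Qed.

Lemma G_iso_swap (l1 e1 s1 l2 e2 s2 : C) :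
  G_iso (tensor_act l1 e1 s1 l2 e2 s2) (tensor_act l2 e2 s2 l1 e1 s1).
Proof.
exists (relabel swap_factor : {linear Mod -> Mod}); split.
  by exists (relabel swap_factor); apply: relabelK swap_factorK.
move=> g m f.
have sw_inj : injective swap_factor := can_inj swap_factorK.
rewrite -[LHS]/(relabel swap_factor _) /tensor_act relabelD addrC.
by congr (_ + _); apply: relabel_omega.
Qed.

Lemma G_iso_trans a1 a2 a3 : G_iso a1 a2 -> G_iso a2 a3 -> G_iso a1 a3.
Proof.
move=> [f [f_bij fE]] [h [h_bij hE]].
exists (h \o f : {linear Mod -> Mod}); split; first exact: bij_comp.
by move=> g m x; rewrite /= fE hE.
Qed.

Lemma tensor_actZ (l1 e1 s1 l2 e2 s2 : C) g m c f :
  tensor_act l1 e1 s1 l2 e2 s2 g m (c *: f) = c *: tensor_act l1 e1 s1 l2 e2 s2 g m f.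
Proof.
have omegaZ s t lam eta sig :
    omega_act s t lam eta sig g m (c *: f) = c *: omega_act s t lam eta sig g m f.
  case: g; rewrite /omega_act ?scaler0 // shiftvZ.
  - by rewrite -scalerAr !scalerA mulrC.
  - by rewrite -scalerAr !scalerA mulrC.
  - by rewrite !scalerA mulrC.
by rewrite /tensor_act !omegaZ scalerDr.
Qed.

(** * The action on 1, and the operators [J_n] along lines *)

Lemma tensor_act_J1 (l1 e1 s1 l2 e2 s2 : C) (n : nat) :
  tensor_act l1 e1 s1 l2 e2 s2 gJ n 1 = (l1 ^+ n * s1 + l2 ^+ n * s2) *: 1.
Proof. by rewrite /tensor_act /= !shiftv1 scalerDl. Qed.

Lemma tensor_act_H1 (l1 e1 s1 l2 e2 s2 : C) (n : nat) :
  tensor_act l1 e1 s1 l2 e2 s2 gH n 1 = l1 ^+ n *: 'X_i0 + l2 ^+ n *: 'X_i2.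
Proof. by rewrite /tensor_act /= !shiftv1 !mulr1. Qed.

Lemma tensor_act_L1 (l1 e1 s1 l2 e2 s2 : C) (n : nat) :
  tensor_act l1 e1 s1 l2 e2 s2 gL n 1 =
  l1 ^+ n *: ('X_i1 + n%:R *: 'X_i0 + (n%:R * e1) *: 1) +
  l2 ^+ n *: ('X_i3 + n%:R *: 'X_i2 + (n%:R * e2) *: 1).
Proof. by rewrite /tensor_act /= !shiftv1 !mulr1 -!alg_mpolyC. Qed.

(** At [n] this polynomial takes the value of [p] at [v] with S replaced by S+1 and T by T-n. It is
    the polynomial factor of [J_n], kept apart from the power of lambda. *)
Definition J_line (s t : 'I_4) (v : 'I_4 -> C) (p : Mod) : {poly C} :=
  mline (fun j => v j + (j == s)%:R) (fun j => - (j == t)%:R) p.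

Lemma meval_J s t (lam eta sig : C) (n : nat) p v : s != t ->
  (omega_act s t lam eta sig gJ n p).@[v] =
  lam ^+ n * (sig *: J_line s t v p).[n%:R].
Proof.
move=> st; rewrite /= mevalZ meval_shiftv hornerZ horner_mline mulrA.
congr (_ * _); apply: meval_eq => j; rewrite -addrA; congr (_ + _).
case: eqP => [->|_]; first by rewrite eq_sym (negPf st) add0r mulN1r.
by rewrite oppr0 mul0r addr0; case: eqP.
Qed.

(** * The image of 1 under an intertwining map *)

Lemma iso_image1_J (l1 e1 s1 l2 e2 s2 l1' e1' s1' l2' e2' s2' : C)
    (phi : {linear Mod -> Mod}) :
  l1 != 0 -> l2 != 0 -> l1' != 0 -> l2' != 0 -> l1' != l2' ->
  (forall g m f, phi (tensor_act l1 e1 s1 l2 e2 s2 g m f) =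
                 tensor_act l1' e1' s1' l2' e2' s2' g m (phi f)) ->
  forall v,
    s1' *: J_line i0 i1 v (phi 1) =
      (s1 * (phi 1).@[v])%:P *+ (l1 == l1') + (s2 * (phi 1).@[v])%:P *+ (l2 == l1') /\
    s2' *: J_line i2 i3 v (phi 1) =
      (s1 * (phi 1).@[v])%:P *+ (l1 == l2') + (s2 * (phi 1).@[v])%:P *+ (l2 == l2').
Proof.
move=> l1n0 l2n0 l1'n0 l2'n0 l12' phiE v.
(* The equation for [J_n] on 1, evaluated at [v]; on the right the polynomial factors are
   constants. *)
have E (n : nat) : l1' ^+ n * (s1' *: J_line i0 i1 v (phi 1)).[n%:R] +
    l2' ^+ n * (s2' *: J_line i2 i3 v (phi 1)).[n%:R] =
    l1 ^+ n * ((s1 * (phi 1).@[v])%:P).[n%:R] + l2 ^+ n * ((s2 * (phi 1).@[v])%:P).[n%:R].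
  rewrite -(@meval_J i0 i1 l1' e1') // -(@meval_J i2 i3 l2' e2') //.
  rewrite -mevalD -[X in X.@[_]]phiE tensor_act_J1 linearZ mevalZ !hornerC.
  by rewrite mulrDl !mulrA.
split; first exact: exp_poly_match E.
have l21' : l2' != l1' by rewrite eq_sym.
by apply: (exp_poly_match l2'n0 l1'n0 l1n0 l2n0 l21') => n; rewrite addrC; exact: E.
Qed.

Lemma J_line_eq s t v p (a : C) : s != t -> J_line s t v p = a%:P ->
  p.@[fun j => v j + (j == s)%:R] = a /\
  p.@[fun j => v j + (j == s)%:R - (j == t)%:R] = a.
Proof.
move=> st E; split.
  have := horner_mline (fun j => v j + (j == s)%:R) (fun j => - (j == t)%:R) p 0.
  rewrite -/(J_line s t v p) E hornerC => ->.
  by apply: meval_eq => j; rewrite mulr0 addr0.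
have := horner_mline (fun j => v j + (j == s)%:R) (fun j => - (j == t)%:R) p 1.
rewrite -/(J_line s t v p) E hornerC => ->.
by apply: meval_eq => j; rewrite mulr1.
Qed.

(** Parameters 0 and 1 of a constant line give invariance in T, while a unit step in S multiplies
    [p] by [a]. A polynomial cannot grow like a power of [a] unless [a = 1] or it vanishes. *)
Lemma J_line_periodic s t p (a : C) : s != t -> p != 0 ->
  (forall v, J_line s t v p = (a * p.@[v])%:P) ->
  [/\ a = 1, forall v, p.@[fun j => v j + (j == s)%:R] = p.@[v]
    & forall v, p.@[fun j => v j + (j == t)%:R] = p.@[v]].
Proof.
move=> st pn0 E.
have Es v : p.@[fun j => v j + (j == s)%:R] = a * p.@[v].
  by have [] := J_line_eq st (E v).
have Et v : p.@[fun j => v j + (j == t)%:R] = p.@[v].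
  (* This base point places parameter 0 of the line at [v] moved by one in T, and parameter 1 at [v]
     itself. *)
  have [E1 E2] := J_line_eq st (E (fun j => v j + (j == t)%:R - (j == s)%:R)).
  transitivity (a * p.@[fun j => v j + (j == t)%:R - (j == s)%:R]).
    by rewrite -E1; apply: meval_eq => j; rewrite subrK.
  by rewrite -E2; apply: meval_eq => j; rewrite subrK addrK.
suff a1 : a = 1 by split=> // v; rewrite Es a1 mul1r.
(* Independence of the bases 1 and [a] requires both to be nonzero. *)
have a0 : a != 0.
  apply/eqP => a0; case/eqP: pn0; apply: Mod_eq => w; rewrite meval0.
  have := Es (fun j => w j - (j == s)%:R); rewrite a0 mul0r => <-.
  by apply: meval_eq => j; rewrite subrK.
apply/eqP/negPn/negP => a1; case/eqP: pn0; apply: Mod_eq => v; rewrite meval0.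
(* The restriction of [p] to the S-direction through [v]: a term of base 1 equal to [p.@[v]] times a
   term of base [a], which forces [p.@[v] = 0]. *)
pose q := mline v (fun j => (j == s)%:R) p.
have q_exp (n : nat) : q.[n%:R] = a ^+ n * p.@[v].
  rewrite horner_mline; elim: n => [|n IHn].
    by rewrite expr0 mul1r; apply: meval_eq => j; rewrite mulr0 addr0.
  rewrite exprS -mulrA -IHn -Es; apply: meval_eq => j.
  by rewrite -natr1 mulrDr mulr1 addrA.
have : \sum_(x <- [:: (1, q); (a, - (p.@[v])%:P)] | x.1 == a) x.2 = 0.
  apply: exp_poly_collect => [|n]; first by rewrite !inE !(eq_sym 0) oner_eq0.
  by rewrite !big_cons big_nil /= q_exp expr1n hornerN hornerC mul1r mulrN addr0 subrr.
rewrite !big_cons big_nil /= eqxx eq_sym (negPf a1) addr0 => /eqP.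
by rewrite oppr_eq0 polyC_eq0 => /eqP.
Qed.

Lemma iso_image1_const (l1 e1 s1 l2 e2 s2 e1' s1' e2' s2' : C)
    (phi : {linear Mod -> Mod}) :
  l1 != 0 -> l2 != 0 -> s1' != 0 -> s2' != 0 -> l1 != l2 -> phi 1 != 0 ->
  (forall g m f, phi (tensor_act l1 e1 s1 l2 e2 s2 g m f) =
                 tensor_act l1 e1' s1' l2 e2' s2' g m (phi f)) ->
  s1 = s1' /\ phi 1 = (phi 1).@[fun=> 0] *: 1.
Proof.
move=> l1n0 l2n0 s1n0 s2n0 l12 p0 phiE.
have J := iso_image1_J l1n0 l2n0 l1n0 l2n0 l12 phiE.
have rescale (a b x : C) (q : {poly C}) : b != 0 -> b *: q = (a * x)%:P ->
    q = (a / b * x)%:P.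
  move=> b0 E; rewrite mulrAC mulrC polyCM -E mul_polyC scalerA mulVf //.
  by rewrite scale1r.
(* As [l1] and [l2] differ, one term survives at base [l1]: the eigenvalue is [s1 / s1'], and it
   must be 1. *)
have [v|a1 P0 P1] := @J_line_periodic i0 i1 (phi 1) (s1 / s1') isT p0.
  apply: rescale => //; have [-> _] := J v.
  by rewrite eqxx [l2 == l1]eq_sym (negPf l12) mulr0n addr0.
have [v|_ P2 P3] := @J_line_periodic i2 i3 (phi 1) (s2 / s2') isT p0.
  apply: rescale => //; have [_ ->] := J v.
  by rewrite eqxx (negPf l12) mulr0n add0r.
split; first by rewrite -[RHS]mul1r -a1 divfK.
rewrite alg_mpolyC; apply: mpoly_periodic_const => i v.
case: i => [[|[|[|[|k]]]]] lt_i; last by [].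
- by rewrite -[RHS]P0; apply: meval_eq.
- by rewrite -[RHS]P1; apply: meval_eq.
- by rewrite -[RHS]P2; apply: meval_eq.
- by rewrite -[RHS]P3; apply: meval_eq.
Qed.

(** * Recovering the parameters from an isomorphism *)

(** A base [l1'] different from [l1] and [l2] has no counterpart in the equation for [J_n], so
    [phi 1] would vanish, against injectivity. *)
Lemma iso_lambda (l1 e1 s1 l2 e2 s2 l1' e1' s1' l2' e2' s2' : C) :
  l1 != 0 -> l2 != 0 -> l1' != 0 -> l2' != 0 -> s1' != 0 -> l1' != l2' ->
  G_iso (tensor_act l1 e1 s1 l2 e2 s2) (tensor_act l1' e1' s1' l2' e2' s2') ->
  l1' = l1 \/ l1' = l2.
Proof.
move=> l1n0 l2n0 l1'n0 l2'n0 s1'n0 l12' [phi [phi_bij phiE]].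
have J := iso_image1_J l1n0 l2n0 l1'n0 l2'n0 l12' phiE.
have [->|n1] := eqVneq l1' l1; first by left.
have [->|n2] := eqVneq l1' l2; first by right.
suff /eqP : phi 1 = 0 by rewrite -(linear0 phi) (bij_eq phi_bij) oner_eq0.
apply: Mod_eq => v; rewrite meval0.
(* The base point is moved back by one in S so that parameter 0 of the line is [v]. *)
have [+ _] := J (fun j => v j - (j == i0)%:R).
rewrite eq_sym (negPf n1) eq_sym (negPf n2) !mulr0n addr0 => /eqP.
rewrite scaler_eq0 (negPf s1'n0) /= => /eqP E.
have [|<- _] := @J_line_eq i0 i1 (fun j => v j - (j == i0)%:R) (phi 1) 0 isT.
  exact: E.
by apply: meval_eq => j; rewrite subrK.
Qed.

Lemma iso_eta_sigma (l1 e1 s1 l2 e2 s2 e1' s1' e2' s2' : C) :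
  l1 != 0 -> l2 != 0 -> s1' != 0 -> s2' != 0 -> l1 != l2 ->
  G_iso (tensor_act l1 e1 s1 l2 e2 s2) (tensor_act l1 e1' s1' l2 e2' s2') ->
  e1 = e1' /\ s1 = s1'.
Proof.
move=> l1n0 l2n0 s1n0 s2n0 l12 [phi [phi_bij phiE]].
have p0 : phi 1 != 0 by rewrite -(linear0 phi) (bij_eq phi_bij) oner_eq0.
have [s11' p_const] := iso_image1_const l1n0 l2n0 s1n0 s2n0 l12 p0 phiE.
split=> //; set c := (phi 1).@[_] in p_const.
have c0 : c != 0 by apply: contra_neq p0; rewrite p_const => ->; rewrite scale0r.
have phiX0 v : (phi 'X_i0).@[v] = c * v i0.
  suff /polyC_inj : ((phi 'X_i0).@[v])%:P = (c * v i0)%:P by [].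
  have E (n : nat) :
      l1 ^+ n * (((phi 'X_i0).@[v])%:P).[n%:R] + l2 ^+ n * (((phi 'X_i2).@[v])%:P).[n%:R] =
      l1 ^+ n * ((c * v i0)%:P).[n%:R] + l2 ^+ n * ((c * v i2)%:P).[n%:R].
    rewrite !hornerC -!mevalZ -mevalD -!linearZ -linearD.
    rewrite -(tensor_act_H1 l1 e1 s1 l2 e2 s2) phiE p_const tensor_actZ tensor_act_H1.
    rewrite mevalZ mevalD !mevalZ !mevalXU mulrDr; congr (_ + _); exact: mulrCA.
  rewrite (exp_poly_match l1n0 l2n0 l1n0 l2n0 l12 E).
  by rewrite eqxx [l2 == l1]eq_sym (negPf l12) mulr0n addr0.
(* Here [k] stands for [n] and [d] for [c], and the zeros are values of variables at the origin;
   both sides are sorted by powers of [k]. *)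
have regroup (F : comNzRingType) (x y a b a' b' k u w u' w' d : F) :
    x * (a + k * b + k * u * (d * 1)) + y * (a' + k * b' + k * w * (d * 1)) =
      d * (x * (0 + k * 0 + k * u' * 1) + y * (0 + k * 0 + k * w' * 1)) ->
    x * (a + (b + u * d) * k) + y * (a' + (b' + w * d) * k) =
      x * (u' * d * k) + y * (w' * d * k).
  by move/eqP; rewrite -subr_eq0 => /eqP E; apply: subr0_eq; rewrite -[RHS]E; ring.
(* Evaluating at the origin removes the S and T terms of the target action, leaving only its eta
   terms. The unknown images of T1 and T2 enter only in degree 0 in [n]. *)
have E (n : nat) :
    l1 ^+ n * (((phi 'X_i1).@[fun=> 0])%:P +
      ((phi 'X_i0).@[fun=> 0] + e1 * c)%:P * 'X).[n%:R] +
    l2 ^+ n * (((phi 'X_i3).@[fun=> 0])%:P +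
      ((phi 'X_i2).@[fun=> 0] + e2 * c)%:P * 'X).[n%:R] =
    l1 ^+ n * ((e1' * c)%:P * 'X).[n%:R] + l2 ^+ n * ((e2' * c)%:P * 'X).[n%:R].
  have := congr1 (meval (fun=> 0)) (phiE gL n 1).
  rewrite tensor_act_L1 p_const tensor_actZ tensor_act_L1.
  rewrite !(linearD, linearZ) /= p_const !(mevalD, mevalZ, meval1, mevalXU).
  rewrite !hornerD !hornerM !hornerC hornerX; apply: regroup.
have := exp_poly_match l1n0 l2n0 l1n0 l2n0 l12 E.
rewrite eqxx [l2 == l1]eq_sym (negPf l12) mulr0n addr0 mulr1n.
(* In degree 1, [phi 'X_i0] contributes [c * 0] at the origin, leaving [e1 * c = e1' * c]. *)
move/(congr1 (fun q : {poly C} => q`_1)).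
rewrite coefD !coefMX !coefC /= add0r phiX0 mulr0 add0r.
exact: mulIf.
Qed.

Lemma G_iso_refl a : G_iso a a.
Proof. by exists (idfun : {linear Mod -> Mod}); split=> //; exists id. Qed.

Lemma iso_parameters (l1 e1 s1 l2 e2 s2 e1' s1' e2' s2' : C) :
  l1 != 0 -> l2 != 0 -> s1' != 0 -> s2' != 0 -> l1 != l2 ->
  G_iso (tensor_act l1 e1 s1 l2 e2 s2) (tensor_act l1 e1' s1' l2 e2' s2') ->
  [/\ e1 = e1', s1 = s1', e2 = e2' & s2 = s2'].
Proof.
move=> l1n0 l2n0 s1n0 s2n0 l12 iso.
have [-> ->] := iso_eta_sigma l1n0 l2n0 s1n0 s2n0 l12 iso.
(* Flipping the factors on both sides turns the second pair of parameters into the first. *)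
have iso' := G_iso_trans (G_iso_swap _ _ _ _ _ _)
  (G_iso_trans iso (G_iso_swap _ _ _ _ _ _)).
have l21 : l2 != l1 by rewrite eq_sym.
by have [-> ->] := iso_eta_sigma l2n0 l1n0 s2n0 s1n0 l21 iso'.
Qed.

Unset Implicit Arguments.
Set Strict Implicit.

Theorem theorem4p8 (l1 l2 l1' l2' s1 s2 s1' s2' e1 e2 e1' e2' : C) :
  l1 != 0 -> l2 != 0 -> l1' != 0 -> l2' != 0 ->
  s1 != 0 -> s2 != 0 -> s1' != 0 -> s2' != 0 ->
  l1 != l2 -> l1' != l2' ->
  (G_iso (tensor_act l1 e1 s1 l2 e2 s2) (tensor_act l1' e1' s1' l2' e2' s2')
   <-> ((l1, e1, s1) = (l1', e1', s1') /\ (l2, e2, s2) = (l2', e2', s2'))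
       \/ ((l1, e1, s1) = (l2', e2', s2') /\ (l2, e2, s2) = (l1', e1', s1'))).
Proof.
move=> l1n0 l2n0 l1n0' l2n0' s1n0 s2n0 s1n0' s2n0' l12 l12'; split; last first.
  move=> [[[-> -> ->] [-> -> ->]]|[[-> -> ->] [-> -> ->]]]; first exact: G_iso_refl.
  exact: G_iso_swap.
move=> iso; have iso_sw := G_iso_trans iso (G_iso_swap _ _ _ _ _ _).
have l21' : l2' != l1' by rewrite eq_sym.
(* Flipping the target places [l2'] too in {[l1], [l2]}; the two cases with [l1' = l2'] contradict
   [l12'], and the other two are the two alternatives. *)
have [E1|E1] := iso_lambda l1n0 l2n0 l1n0' l2n0' s1n0' l12' iso;
  have [E2|E2] := iso_lambda l1n0 l2n0 l2n0' l1n0' s2n0' l21' iso_sw;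
  rewrite {}E1 {}E2 ?eqxx // in l12' iso iso_sw *.
- by left; have [-> -> -> ->] := iso_parameters l1n0 l2n0 s1n0' s2n0' l12 iso.
- by right; have [-> -> -> ->] := iso_parameters l1n0 l2n0 s2n0' s1n0' l12 iso_sw.
Qed.
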